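(* For $i=1,2$ let $G_i$ be a graph with $m_i$ edges and with no isolated vertices. If $m=\max\{m_1,m_2\}$, then $R(G_1,G_2)\le 2^{250\sqrt{m}}$.
   Context: Graphs are finite and simple. For graphs $G_1,G_2$, the Ramsey number $R(G_1,G_2)$ is the smallest positive integer $N$ such that every blue-red edge coloring of the complete graph $K_N$ contains a blue subgraph isomorphic to $G_1$ or a red subgraph isomorphic to $G_2$. *)

(* Defs.v *)
From mathcomp Require Import all_boot.

Set Implicit Arguments.
Unset Strict Implicit.
Unset Printing Implicit Defensive.

Record sgraph := SGraph {
  vertex :> finType;
  adj : rel vertex;
  adj_sym : symmetric adj;
  adj_irrefl : irreflexive adj }.

Arguments adj {_}.

Definition edges (G : sgraph) : {set {set G}} :=
  [set [set p.1; p.2] | p in [set p : G * G | adj p.1 p.2]].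

Definition no_isolated (G : sgraph) : Prop :=
  forall x : G, exists y : G, adj x y.

(* H has a subgraph isomorphic to G: such a subgraph is the image of an
   injective, adjacency-preserving map; it need not be induced, so
   non-adjacency need not be preserved. *)
Definition contains_copy (G H : sgraph) : bool :=
  [exists f : {ffun G -> H},
     injectiveb f && [forall x, forall y, adj x y ==> adj (f x) (f y)]].

Definition blue : bool := true.
Definition red : bool := false.

(* Colorings are total on {set 'I_N}, but only the values on two-element sets,
   i.e. on the edges of the complete graph, are ever used. *)
Definition coloring (N : nat) := {ffun {set 'I_N} -> bool}.

Definition color_rel N (c : coloring N) (k : bool) : rel 'I_N :=
  fun x y => (x != y) && (c [set x; y] == k).

Lemma color_rel_sym N (c : coloring N) k : symmetric (color_rel c k).
Proof. by move=> x y; rewrite /color_rel eq_sym setUC. Qed.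

Lemma color_rel_irrefl N (c : coloring N) k : irreflexive (color_rel c k).
Proof. by move=> x; rewrite /color_rel eqxx. Qed.

Definition color_class N (c : coloring N) (k : bool) : sgraph :=
  SGraph (@color_rel_sym N c k) (@color_rel_irrefl N c k).

Definition arrows (G1 G2 : sgraph) (N : nat) : bool :=
  [forall c : coloring N,
     contains_copy G1 (color_class c blue)
     || contains_copy G2 (color_class c red)].

Lemma mono_clique N (c : coloring N) n a b (A : {set 'I_N}) :
  a + b = n -> 2 ^ n <= #|A| ->
  (exists S : {set 'I_N}, [/\ S \subset A, #|S| = a &
     {in S &, forall x y, x != y -> color_rel c blue x y}]) \/
  (exists S : {set 'I_N}, [/\ S \subset A, #|S| = b &
     {in S &, forall x y, x != y -> color_rel c red x y}]).
Proof.
elim: n a b A => [|n IHn] [|a] [|b] A //.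
1,2: by left; exists set0; split;
  rewrite ?sub0set ?cards0 // => x y; rewrite inE.
- by right; exists set0; split;
    rewrite ?sub0set ?cards0 // => x y; rewrite inE.
rewrite addSn => -[] Hab HA.
have /card_gt0P [v vA] : 0 < #|A| by apply: leq_trans HA; rewrite expn_gt0.
pose B k := [set y in A | color_rel c k v y].
have HAB : A :\ v \subset B blue :|: B red.
  apply/subsetP=> y; rewrite !inE /color_rel => /andP[yv ->] /=.
  by rewrite eq_sym yv; case: (c _).
have cardAB : #|A|.-1 <= #|B blue| + #|B red|.
  have := subset_leq_card HAB; rewrite (cardsD1 v A) vA /=.
  by move=> H; apply: leq_trans H _; rewrite cardsU leq_subr.
have BA k : B k \subset A by apply/subsetP=> y; rewrite inE => /andP[].
have vB k : v \notin B k by rewrite inE /color_rel eqxx andbF.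
have extend k p : (exists S : {set 'I_N}, [/\ S \subset B k, #|S| = p &
     {in S &, forall x y, x != y -> color_rel c k x y}]) ->
  (exists S : {set 'I_N}, [/\ S \subset A, #|S| = p.+1 &
     {in S &, forall x y, x != y -> color_rel c k x y}]).
  case=> S [SB Sp Sc]; exists (v |: S); split.
  - by rewrite subUset sub1set vA (subset_trans SB).
  - by rewrite cardsU1 Sp (contra (subsetP SB v)) ?vB.
  have vS y : y \in S -> color_rel c k v y.
    by move=> /(subsetP SB); rewrite inE => /andP[].
  move=> x y; rewrite !in_setU1 => /orP[/eqP->|xS] /orP[/eqP->|yS] xy.
  - by rewrite eqxx in xy.
  - exact: vS.
  - by rewrite color_rel_sym vS.
  exact: Sc.
have widen k p : (exists S : {set 'I_N}, [/\ S \subset B k, #|S| = p &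
     {in S &, forall x y, x != y -> color_rel c (~~ k) x y}]) ->
  (exists S : {set 'I_N}, [/\ S \subset A, #|S| = p &
     {in S &, forall x y, x != y -> color_rel c (~~ k) x y}]).
  by case=> S [SB Sp Sc]; exists S; split=> //; apply: subset_trans (BA k).
case: (leqP (2 ^ n) #|B blue|) => [Hb|Hb].
  case: (IHn a b.+1 (B blue) Hab Hb); first by move/extend; left.
  by move/(widen blue); right.
have Hr : 2 ^ n <= #|B red|.
  have H : (2 ^ n + 2 ^ n).-1 <= #|B blue| + #|B red|.
    rewrite addnn -mul2n -expnS; apply: leq_trans cardAB.
    by rewrite -!subn1 leq_sub2r.
  rewrite leqNgt; apply/negP => Hr.
  have : (#|B blue| + #|B red|).+2 <= 2 ^ n + 2 ^ n.
    by rewrite -addnS -addSn leq_add.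
  by case: (2 ^ n + 2 ^ n) H => //= q H; rewrite ltnS ltnNge H.
have Hab' : a.+1 + b = n by rewrite addSnnS.
case: (IHn a.+1 b (B red) Hab' Hr); first by move/(widen red); left.
by move/extend; right.
Qed.

Lemma clique_copy (G : sgraph) N (c : coloring N) k (S : {set 'I_N}) :
  #|S| = #|G| -> {in S &, forall x y, x != y -> color_rel c k x y} ->
  contains_copy G (color_class c k).
Proof.
move=> SG Sc; pose f x : 'I_N := enum_val (cast_ord (esym SG) (enum_rank x)).
have fI : injective f.
  by move=> x y /enum_val_inj /cast_ord_inj /enum_rank_inj.
apply/existsP; exists [ffun x : G => f x : color_class c k].
apply/andP; split; first by apply/injectiveP=> x y; rewrite !ffunE => /fI.
apply/forallP=> x; apply/forallP=> y; apply/implyP=> xy; rewrite !ffunE /=.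
apply: Sc; rewrite ?enum_valP // (inj_eq fI); apply/eqP=> exy.
by rewrite exy adj_irrefl in xy.
Qed.

Lemma ramsey_exists (G1 G2 : sgraph) :
  exists N, (0 < N) && arrows G1 G2 N.
Proof.
exists (2 ^ (#|G1| + #|G2|)); rewrite expn_gt0 /=; apply/forallP=> c.
have H : 2 ^ (#|G1| + #|G2|) <= #|[set: 'I_(2 ^ (#|G1| + #|G2|))]|.
  by rewrite cardsT card_ord.
case: (mono_clique c erefl H) => -[S [_ SG Sc]].
  by rewrite (clique_copy SG Sc).
by rewrite (clique_copy SG Sc) orbT.
Qed.

Definition ramsey_number (G1 G2 : sgraph) : nat :=
  ex_minn (ramsey_exists G1 G2).

(* Main.v *)
Require Import Defs.
From mathcomp Require Import all_boot all_order all_algebra.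
From mathcomp Require Import reals exp.
From mathcomp Require Import zify.

Set Implicit Arguments.
Unset Strict Implicit.
Unset Printing Implicit Defensive.

(** Let [s] be the integer part of the square root of [m]; it suffices that
every coloring of the complete graph on [2 ^ (250 * s)] vertices contains one
of the two copies. The argument is Sudakov's.

Call [(X, Y)] a monochromatic pair of color [k] when [X] is a clique of color
[k] and all edges between [X] and [Y] have color [k]. Given such a pair with
[#|X| = t], try to build a copy of [G k] by placing its [t] vertices of
highest degree in [X] and the others in [Y]. The others have degree at most
[2m / t], so a greedy embedding into [Y] is cheap; if it fails, there are two
large subsets of [Y] with few edges of color [k] between them
([embeds_or_sparse]). As no subset of [Y] admits the embedding, such pairs can
be found repeatedly and assembled into a large set [W] in which color [k] has
density at most a prescribed [delta] ([sparse_pairs_sparse_set],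
[half_low_degree]).

In [W] the other color is so dominant that a monochromatic pair, of either
color, with a clique of size [2t] exists at the cost of a factor [2 ^ O(delta
* t * log (1 / delta))] ([sparse_mono_pair]). The clique has doubled
([mono_pair_step]), and the failing embedding of the next round is cheaper
because the degree bound [2m / t] has been halved.

Start with [t = 32 * s], which Erdos and Szekeres' argument provides
([mono_pair_walk]). When [t = s * 2 ^ p], taking [delta] about [4 ^ (- p)]
makes the round divide [#|Y|] by at most [2 ^ (s * O(p ^ 2) / 2 ^ p)]. These
exponents form a convergent series, so [Y] stays large through all rounds
([no_large_pair]) until [X] has at least as many vertices as [G k]: then [X]
alone contains the copy. The estimates need [s] to be at least [10]; below
that, the bound [2 ^ (#|G1| + #|G2|)] is good enough. *)

(** * Degrees *)

Definition deg (G : sgraph) (x : G) : nat := #|[set y : G | adj x y]|.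

(** The handshake lemma: an edge has at most two orientations. *)
Lemma sum_deg (G : sgraph) : \sum_(x : G) deg x <= 2 * #|edges G|.
Proof.
pose P := [set p : G * G | adj p.1 p.2].
have -> : \sum_(x : G) deg x = #|P|.
  under eq_bigr => x _ do rewrite /deg -sum1dep_card.
  by rewrite pair_big_dep /= sum1dep_card; apply: eq_card => p; rewrite !inE.
rewrite -sum1_card (partition_big_imset (fun p : G * G => [set p.1; p.2])) /=.
rewrite -/(edges G) mulnC -sum_nat_const.
apply: leq_sum => e /imsetP[[a b] _ ->] /=.
rewrite sum1dep_card.
apply: (@leq_trans #|[set (a, b); (b, a)]|); last by rewrite cards2; case: eqP.
apply/subset_leq_card/subsetP=> -[x y]; rewrite !inE /= !xpair_eqE.
case/andP=> xy /eqP E.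
have xny : x != y by apply: contraTneq xy => ->; rewrite adj_irrefl.
have := set21 x y; have := set22 x y; rewrite E !inE.
by case/orP=> /eqP Ey /orP[] /eqP Ex; subst x y; rewrite ?eqxx ?orbT // in xny *.
Qed.

Lemma card_no_isolated (G : sgraph) : no_isolated G -> #|G| <= 2 * #|edges G|.
Proof.
move=> iG; apply: leq_trans (sum_deg G); rewrite -sum1_card.
apply: leq_sum => x _; have [y xy] := iG x.
by apply/card_gt0P; exists y; rewrite inE.
Qed.

(** Each vertex outside the [t] vertices of highest degree has degree at most
the average of those [t] degrees. *)
Lemma top_degrees (G : sgraph) t : t <= #|G| ->
  exists2 S : {set G}, #|S| = t &
    forall v, v \notin S -> deg v * t <= 2 * #|edges G|.
Proof.
move=> tG.
have [S St Smax] : exists2 S : {set G}, #|S| = t &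
    forall v u, v \notin S -> u \in S -> deg v <= deg u.
  elim: t tG => [|t IHt] tG.
    by exists set0; rewrite ?cards0 // => v u _; rewrite inE.
  have [S St Smax] := IHt (ltnW tG).
  have /card_gt0P[v0 v0S] : 0 < #|~: S| by rewrite cardsCs setCK St subn_gt0.
  case: (@arg_maxnP _ v0 (fun v => v \in ~: S) (@deg G) v0S) => w wS wmax.
  exists (w |: S); first by rewrite cardsU1 St -in_setC wS.
  move=> v u; rewrite !inE negb_or => /andP[vw vS] /predU1P[->|]; last exact: Smax.
  by apply: wmax; rewrite inE.
exists S => // v vS; apply: leq_trans (sum_deg G).
rewrite mulnC -St -sum_nat_const [leqRHS](bigID (mem S)) /=.
by apply: leq_trans (leq_addr _ _); apply: leq_sum => u; apply: Smax.
Qed.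

(** * Greedy embedding *)

Lemma leq_card_bigcup (I T : finType) (L : {set I}) (A : I -> {set T}) :
  #|\bigcup_(w in L) A w| <= \sum_(w in L) #|A w|.
Proof.
elim/big_rec2: _ => [|w n B _ Bn]; first by rewrite cards0.
by rewrite cardsU; apply: leq_trans (leq_subr _ _) _; rewrite leq_add2l.
Qed.

Definition nbrs (T : finType) (r : rel T) (x : T) (B : {set T}) : {set T} :=
  [set y in B | r x y].

Section Embedding.

Context (T : finType) (r : rel T) (G : sgraph) (S : {set G}).

Definition embeds_in (f : G -> T) (D : {set G}) (Y : {set T}) : Prop :=
  [/\ {in D, forall v, f v \in Y}, {in D &, injective f} &
      {in D &, forall u v, adj u v -> r (f u) (f v)}].

Definition candidates (f : G -> T) (D : {set G}) (Y : {set T}) (v : G) :=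
  [set y in Y | [forall u in D, adj v u ==> r (f u) y]].

(** The vertices of [S] are embedded one at a time, keeping the candidate set
of each vertex still to be placed at least [2 ^ (- e)] times its former size
whenever one of its neighbours is placed; as degrees are at most [d], it never
drops below [2 ^ (- e * d) * #|Y|]. If a vertex [v] cannot be placed, every
free candidate [x] of [v] has too few neighbours among the candidates of some
unplaced neighbour [w] of [v]; there are at most [d] such [w], so one of them is
responsible for a [1 / d] proportion of the [x], and these [x] together with
the candidates of [w] are the sparse pair. *)
Lemma embeds_or_sparse d e (Y : {set T}) : symmetric r ->
    {in S, forall v, deg v <= d} ->
    2 * #|G| * 2 ^ (e * d) < #|Y| ->
  (exists f, embeds_in f S Y) \/
  (exists A B : {set T}, [/\ A \subset Y, B \subset Y,
     #|Y| <= 2 ^ (e.+1 * d).+1 * #|A|, #|Y| <= 2 ^ (e * d) * #|B| &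
     {in A, forall x, 2 ^ e * #|nbrs r x B| <= #|B|}]).
Proof.
move=> r_sym Sd bigY.
case: (boolP [exists A : {set T}, exists B : {set T},
   [&& A \subset Y, B \subset Y, #|Y| <= 2 ^ (e.+1 * d).+1 * #|A|,
       #|Y| <= 2 ^ (e * d) * #|B| &
       [forall x in A, 2 ^ e * #|nbrs r x B| <= #|B|]]]).
  case/existsP=> A /existsP[B /and5P[AY BY hA hB /forall_inP AB]].
  by right; exists A, B; split.
move=> noAB; left.
have {noAB} noAB (A B : {set T}) : A \subset Y -> B \subset Y ->
    #|Y| <= 2 ^ (e * d) * #|B| ->
    {in A, forall x, 2 ^ e * #|nbrs r x B| <= #|B|} ->
    2 ^ (e.+1 * d).+1 * #|A| <= #|Y|.
  move=> AY BY hB AB; apply: contraNT noAB; rewrite -ltnNge => hA.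
  apply/existsP; exists A; apply/existsP; exists B.
  by rewrite AY BY (ltnW hA) hB; apply/forall_inP.
have /card_gt0P[y0 y0Y] : 0 < #|Y| by apply: leq_ltn_trans bigY.
(* Placing the neighbours of v one by one shrinks its candidate set at most
   geometrically. *)
suff: forall n, n <= #|S| -> exists D : {set G}, exists f,
    [/\ D \subset S, #|D| = n, embeds_in f D Y & {in S :\: D, forall v,
     #|Y| <= 2 ^ (e * #|[set u in D | adj v u]|) * #|candidates f D Y v|}].
  case/(_ _ (leqnn _))=> D [f [DS cD fD _]]; exists f.
  by have <- : D = S by apply/eqP; rewrite eqEcard DS cD leqnn.
elim=> [|n IHn] nS.
  exists set0, (fun=> y0); split; rewrite ?sub0set ?cards0 //.
    by split=> u; rewrite ?inE // => v; rewrite inE.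
  move=> v _; rewrite (_ : candidates _ _ _ _ = Y); last first.
    apply/setP=> y; rewrite inE andb_idr // => _.
    by apply/forall_inP=> u; rewrite inE.
  by rewrite leq_pmull // expn_gt0.
have [D [f [DS cD [fY fI fA] fC]]] := IHn (ltnW nS).
have [v vS vD] : exists2 v, v \in S & v \notin D.
  have /subsetPn[v vS vD] : ~~ (S \subset D); last by exists v.
  by apply/negP=> /subset_leq_card; rewrite cD leqNgt nS.
pose C := candidates f D Y.
have CY w : C w \subset Y by apply/subsetP=> y; rewrite inE => /andP[].
have dD w : w \in S -> #|[set u in D | adj w u]| <= d.
  move=> wS; apply: leq_trans (Sd w wS); apply: subset_leq_card.
  by apply/subsetP=> u; rewrite !inE => /andP[].
have bigC w : w \in S -> w \notin D -> #|Y| <= 2 ^ (e * d) * #|C w|.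
  move=> wS wD; apply: leq_trans (fC w _) _; first by rewrite inE wD.
  by rewrite leq_mul2r leq_exp2l // leq_mul2l dD ?orbT.
pose L := [set w in S :\: D | adj v w].
have [x xC xL] : exists2 x, x \in C v :\: f @: D &
    {in L, forall w, #|C w| <= 2 ^ e * #|nbrs r x (C w)|}.
  pose A w := [set x in C v | 2 ^ e * #|nbrs r x (C w)| <= #|C w|].
  case: (boolP [exists x in C v :\: f @: D,
      [forall w in L, #|C w| <= 2 ^ e * #|nbrs r x (C w)|]]).
    by case/exists_inP=> x xC /forall_inP xL; exists x.
  rewrite negb_exists_in => /forall_inP bad; exfalso.
  have sub : C v :\: f @: D \subset \bigcup_(w in L) A w.
    apply/subsetP=> x xC; have := bad x xC; rewrite negb_forall_in.
    case/exists_inP=> w wL hw; apply/bigcupP; exists w => //.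
    by case/setDP: xC => xC _; rewrite inE xC /= ltnW // ltnNge.
  have cardL : #|L| <= d.
    apply: leq_trans (Sd v vS); apply: subset_leq_card.
    by apply/subsetP=> w; rewrite !inE => /andP[].
  have smallA w : w \in L -> 2 ^ (e.+1 * d).+1 * #|A w| <= #|Y|.
    rewrite !inE => /andP[/andP[wD wS] vw]; apply: noAB (CY w) _ _.
    - by apply: subset_trans (CY v); apply/subsetP=> x; rewrite inE => /andP[].
    - exact: bigC.
    by move=> x; rewrite inE => /andP[].
  have sumA : 2 ^ (e.+1 * d).+1 * #|C v :\: f @: D| <= d * #|Y|.
    apply: (@leq_trans (\sum_(w in L) #|Y|)); last first.
      by rewrite sum_nat_const leq_mul2r cardL orbT.
    apply: (@leq_trans (\sum_(w in L) 2 ^ (e.+1 * d).+1 * #|A w|)); last first.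
      exact: leq_sum.
    rewrite -big_distrr /= leq_mul2l; apply/orP; right.
    by apply: leq_trans (subset_leq_card sub) _; apply: leq_card_bigcup.
  have CvG : #|C v| <= #|C v :\: f @: D| + #|G|.
    rewrite -(cardsID (f @: D) (C v)) addnC leq_add2l.
    apply: leq_trans (subset_leq_card (subsetIr _ _)) _.
    by apply: leq_trans (leq_imset_card _ _) (max_card _).
  (* At most half of the candidates of v are occupied, and the bounds smallA
     leave room for fewer than half of them to be bad. *)
  have d2 : d < 2 ^ d by exact: ltn_expl.
  have := bigC v vS vD; rewrite mulSn expnS expnD in sumA.
  have : d * #|Y| <= 2 ^ d * #|Y| by rewrite leq_mul2r ltnW ?orbT.
  have : 0 < 2 ^ d by rewrite expn_gt0.
  have := leq_mul (leqnn (2 ^ (e * d))) CvG.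
  move: (2 ^ (e * d)) (2 ^ d) sumA bigY d2 => p q; nia.
exists (v |: D), (fun z => if z == v then x else f z).
have neqv u : u \in D -> (u == v) = false.
  by move=> uD; apply: contraNF vD => /eqP <-.
case/setDP: xC => xCv xfD.
have xfv u : u \in D -> (f u == x) = false.
  by move=> uD; apply: contraNF xfD => /eqP <-; apply: imset_f.
have /andP[xY /forall_inP xadj] :
    (x \in Y) && [forall u in D, adj v u ==> r (f u) x].
  by rewrite inE in xCv.
split.
- by rewrite subUset sub1set vS.
- by rewrite cardsU1 vD cD.
- split.
  + by move=> u /setU1P[->|uD]; rewrite ?eqxx // neqv // fY.
  + move=> u w /setU1P[->|uD] /setU1P[->|wD]; rewrite ?eqxx ?neqv //.
    * by move/eqP; rewrite eq_sym xfv.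
    * by move/eqP; rewrite xfv.
    * exact: fI.
  + move=> u w /setU1P[->|uD] /setU1P[->|wD]; rewrite ?eqxx ?neqv //.
    * by rewrite adj_irrefl.
    * by move=> vw; rewrite r_sym; exact: (implyP (xadj w wD)).
    * by rewrite adj_sym => vu; exact: (implyP (xadj u uD)).
    * exact: fA.
move=> w; rewrite !inE negb_or -andbA => /and3P[wv wD wS].
have wSD : w \in S :\: D by rewrite inE wD.
have cand y : (y \in candidates (fun z => if z == v then x else f z) (v |: D) Y w)
    = (y \in C w) && (adj w v ==> r x y).
  rewrite !inE -andbA; congr (_ && _); apply/forall_inP/andP.
    move=> H; split; last by have := H v (setU11 _ _); rewrite eqxx.
    by apply/forall_inP=> u uD; have := H u (setU1r _ uD); rewrite neqv.
  case=> /forall_inP H Hv u /setU1P[->|uD]; first by rewrite eqxx.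
  by rewrite neqv // H.
case: (boolP (adj w v)) => wv_adj.
  rewrite (_ : [set u in v |: D | adj w u] = v |: [set u in D | adj w u]);
    last first.
    by apply/setP=> u; rewrite !inE; case: eqP => [->|]; rewrite ?wv_adj.
  rewrite cardsU1 inE (negbTE vD) /= mulnDr muln1 expnD -mulnA mulnCA.
  rewrite (_ : candidates _ _ _ _ = nbrs r x (C w)); last first.
    by apply/setP=> y; rewrite cand wv_adj [RHS]inE.
  apply: leq_trans (fC w wSD) _; rewrite leq_mul2l; apply/orP; right.
  by apply: xL; rewrite inE wSD adj_sym.
rewrite (_ : [set u in v |: D | adj w u] = [set u in D | adj w u]); last first.
  apply/setP=> u; rewrite !inE.
  by case: eqP => [->|]; rewrite ?(negbTE wv_adj) ?andbF.
rewrite (_ : candidates _ _ _ _ = C w); first exact: fC.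
by apply/setP=> y; rewrite cand (negbTE wv_adj) andbT.
Qed.

End Embedding.

(** * From sparse pairs to sparse sets *)

Lemma subset_of_card (T : finType) (A : {set T}) n : n <= #|A| ->
  exists2 B : {set T}, B \subset A & #|B| = n.
Proof.
move=> nA; exists [set x in take n (enum A)].
  by apply/subsetP=> x; rewrite inE => /mem_take; rewrite mem_enum.
rewrite cardsE (card_uniqP _) ?take_uniq ?enum_uniq // size_takel //.
by rewrite -cardE.
Qed.

Section SparseSets.

Context (T : finType) (r : rel T).
Hypothesis r_sym : symmetric r.

(** Related pairs are counted with order: for irreflexive [r], [links W W] is
twice the number of edges inside [W]. *)
Definition links (U V : {set T}) : nat := \sum_(x in U) #|nbrs r x V|.

Lemma card_nbrs_sum x (V : {set T}) : #|nbrs r x V| = \sum_(y in V) r x y.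
Proof.
by rewrite -sum1dep_card big_mkcondr; apply: eq_bigr => y _; case: (r x y).
Qed.

Lemma links_sym (U V : {set T}) : links U V = links V U.
Proof.
rewrite /links; under eq_bigr => x _ do rewrite card_nbrs_sum.
rewrite exchange_big; apply: eq_bigr => y _ /=.
by rewrite card_nbrs_sum; apply: eq_bigr => x _; rewrite r_sym.
Qed.

Lemma links_le (U V : {set T}) : links U V <= #|U| * #|V|.
Proof.
rewrite -sum_nat_const; apply: leq_sum => x _; apply: subset_leq_card.
by apply/subsetP=> y; rewrite inE => /andP[].
Qed.

Lemma links_bound (U V : {set T}) q b :
  {in U, forall x, q * #|nbrs r x V| <= b} -> q * links U V <= #|U| * b.
Proof.
by move=> h; rewrite /links big_distrr -sum_nat_const; apply: leq_sum.
Qed.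

Lemma linksU (U V : {set T}) : [disjoint U & V] ->
  links (U :|: V) (U :|: V) = links U U + links V V + 2 * links U V.
Proof.
move=> dUV.
have sumU F : \sum_(x in U :|: V) F x = \sum_(x in U) F x + \sum_(x in V) F x.
  by rewrite -bigU //; apply: eq_bigl => x; rewrite inE.
have split_nbrs x : #|nbrs r x (U :|: V)| = #|nbrs r x U| + #|nbrs r x V|.
  by rewrite !card_nbrs_sum sumU.
rewrite {1}/links; under eq_bigr => x _ do rewrite split_nbrs.
by rewrite sumU !big_split /= -!/(links _ _) (links_sym V U); lia.
Qed.

(** Markov's inequality. *)
Lemma few_rich (A U : {set T}) q b : q * links A U <= #|A| * b ->
  2 * #|[set x in A | 2 * b < q * #|nbrs r x U|]| <= #|A|.
Proof.
set D := [set x in A | _] => h.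
have : #|D| * (2 * b).+1 <= #|A| * b.
  apply: leq_trans h; rewrite /links big_distrr -sum_nat_const /=.
  rewrite [leqRHS](bigID (mem D)) /=; apply: leq_trans (leq_addr _ _).
  rewrite [leqRHS](eq_bigl (mem D)); last first.
    by move=> x; rewrite !inE andb_idl // => /andP[].
  by apply: leq_sum => x; rewrite inE => /andP[].
case: b {h} @D => [|b] D; nia.
Qed.

(** In a sparse pair [(A, B)] one finds by induction a sparse [U] in [A], and
then a sparse [V] of the same size among the points of [B] having few
neighbours in [U]. Passing from [U] and [V] to their union halves the density
inside the parts and adds [2 ^ (- e)] for the pairs in between, so that after
[j] rounds the density is at most [2 ^ (- j) + 2 * 2 ^ (- e)], which is the
last inequality multiplied by [2 ^ (e + j)]. *)
Lemma sparse_pairs_sparse_set e l M0 u0 (Y : {set T}) :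
    (forall Y' : {set T}, Y' \subset Y -> M0 <= #|Y'| ->
      exists A B : {set T}, [/\ A \subset Y', B \subset Y',
        #|Y'| <= 2 ^ l * #|A|, #|Y'| <= 2 ^ l * #|B| &
        {in A, forall x, 2 ^ e * #|nbrs r x B| <= #|B|}]) ->
    M0 <= 2 ^ l * u0 ->
  forall j (Y' : {set T}), Y' \subset Y -> 2 ^ (l.+2 * j) * u0 <= #|Y'| ->
  exists W : {set T}, [/\ W \subset Y', #|W| = 2 ^ j * u0 &
    2 ^ (e + j) * links W W <= (2 ^ e + 2 * 2 ^ j) * #|W| ^ 2].
Proof.
move=> pairs Mu; elim=> [|j IHj] Y' Y'Y; rewrite ?muln0 ?mulnS.
  rewrite expn0 mul1n => uY'; have [W WY' Wu] := subset_of_card uY'.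
  exists W; split=> //; rewrite addn0.
  have := links_le W W; move: (2 ^ e) => p; nia.
rewrite addSn addSn !expnS expnD => bigY'.
have pj : 0 < 2 ^ (l.+2 * j) by rewrite expn_gt0.
have pl : 0 < 2 ^ l by rewrite expn_gt0.
have MY' : M0 <= #|Y'|.
  apply: leq_trans Mu _; apply: leq_trans bigY'; rewrite leq_mul2r.
  by apply/orP; right; nia.
have [A [B [AY' BY' hA hB AB]]] := pairs Y' Y'Y MY'.
have hA' : 4 * (2 ^ (l.+2 * j) * u0) <= #|A| by nia.
have hB' : 4 * (2 ^ (l.+2 * j) * u0) <= #|B| by nia.
have [U [UA cU dU]] := IHj A (subset_trans AY' Y'Y) ltac:(lia).
pose B0 := [set y in B | 2 * #|U| < 2 ^ e * #|nbrs r y U|].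
have hB0 : 2 * #|B0| <= #|B|.
  apply: few_rich; rewrite links_sym mulnC [leqRHS]mulnC mulnC.
  by apply: links_bound => x /(subsetP UA); apply: AB.
have jl : 2 ^ j <= 2 ^ (l.+2 * j) by rewrite leq_exp2l // leq_pmull.
(* Half of B survives the removal of B0, and U is at most a quarter of B; this
   and the factor 2 ^ l of the pair make up the exponent l.+2. *)
have hBU : #|B| <= 4 * #|B :\: B0 :\: U|.
  have B0B : B0 \subset B by apply/subsetP=> y; rewrite inE => /andP[].
  have := cardsD B B0; rewrite (setIidPr B0B).
  have := cardsD (B :\: B0) U.
  have := subset_leq_card (subsetIr (B :\: B0) U); nia.
have BUB : B :\: B0 :\: U \subset B.
  exact: subset_trans (subsetDl _ _) (subsetDl _ _).
have BUY := subset_trans BUB (subset_trans BY' Y'Y).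
have [V [VB cV dV]] := IHj _ BUY ltac:(lia).
have dUV : [disjoint U & V].
  rewrite disjoint_sym disjoints_subset; apply/subsetP=> y /(subsetP VB).
  by rewrite !inE => /andP[].
have cUV : #|U :|: V| = #|U| + #|V|.
  by rewrite cardsU (disjoint_setI0 dUV) cards0 subn0.
exists (U :|: V); split.
- by rewrite subUset (subset_trans UA) // (subset_trans VB) // (subset_trans BUB).
- by rewrite cUV cU cV; lia.
have dVU : 2 ^ e * links U V <= 2 * #|U| ^ 2.
  rewrite links_sym; have -> : 2 * #|U| ^ 2 = #|V| * (2 * #|U|) by rewrite cU cV; lia.
  apply: links_bound => y /(subsetP VB); rewrite !inE.
  by case/and3P=> _ h yB; rewrite yB /= -leqNgt in h.
have cVU : #|V| = #|U| by rewrite cU cV.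
have -> : 2 ^ (e + j.+1) = 2 * (2 ^ e * 2 ^ j) by rewrite addnS expnS expnD.
have h : 2 ^ j * (2 ^ e * links U V) <= 2 ^ j * (2 * #|U| ^ 2).
  by rewrite leq_mul2l dVU orbT.
rewrite linksU // cUV cVU !(expnD, expnS 2 j) -!mulnn in dU dV h *.
move: (links U U) (links V V) (links U V) (2 ^ e) (2 ^ j) (#|U|) dU dV h.
move=> a b c p q u dU dV h; lia.
Qed.

Lemma half_low_degree e (W : {set T}) : 2 ^ e * links W W <= 4 * #|W| ^ 2 ->
  exists W' : {set T}, [/\ W' \subset W, #|W| <= 2 * #|W'| &
    {in W', forall x, 2 ^ e * #|nbrs r x W'| <= 16 * #|W'|}].
Proof.
move=> h; have {}h : 2 ^ e * links W W <= #|W| * (4 * #|W|) by lia.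
have := few_rich h; set D := [set x in W | _] => hD.
have DW : D \subset W by apply/subsetP=> y; rewrite inE => /andP[].
have cD := cardsD W D; rewrite (setIidPr DW) in cD.
exists (W :\: D); split; [exact: subsetDl | lia |] => x.
rewrite inE => /andP[xD xW]; have : 2 ^ e * #|nbrs r x W| <= 8 * #|W|.
  by rewrite leqNgt; apply: contra xD; rewrite inE xW /=; lia.
have : #|nbrs r x (W :\: D)| <= #|nbrs r x W|.
  by apply/subset_leq_card/subsetP=> y; rewrite !inE => /andP[/andP[_ ->] ->].
move: (2 ^ e) => p; nia.
Qed.

End SparseSets.

(** * Monochromatic pairs *)

(** Bernoulli's inequality [1 - j / q <= (1 - 1 / q) ^ j]. *)
Lemma bernoulli_nat q j : j <= q -> (q - j) * q ^ j <= q * (q - 1) ^ j.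
Proof.
elim: j => [|j IHj] jq; first by rewrite subn0.
have := IHj (ltnW jq); rewrite !expnS; move: (q ^ j) ((q - 1) ^ j) => a b h.
have [k qE] : exists k, q = j.+1 + k by exists (q - j.+1); lia.
subst q; move: h; have -> : j.+1 + k - j = k.+1 by lia.
have -> : j.+1 + k - j.+1 = k by lia.
have -> : j.+1 + k - 1 = j + k by lia.
move=> h; have := leq_mul (leqnn (j + k)) h; nia.
Qed.

(** Keeping [n] times all but a [2 ^ (- g.+1)] proportion of a set loses at
most a factor [2] in each run of [2 ^ g] steps. *)
Lemma pow_loss g c n : n <= c * 2 ^ g ->
  2 ^ (g.+1 * n) <= 2 ^ c * (2 ^ g.+1 - 1) ^ n.
Proof.
move=> nc; rewrite expnM.
have pg : 0 < 2 ^ g by rewrite expn_gt0.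
have base : (2 ^ g.+1) ^ (2 ^ g) <= 2 * (2 ^ g.+1 - 1) ^ (2 ^ g).
  have := @bernoulli_nat (2 ^ g.+1) (2 ^ g) ltac:(by rewrite leq_exp2l).
  have -> : 2 ^ g.+1 - 2 ^ g = 2 ^ g by rewrite expnS mul2n -addnn addnK.
  by rewrite [X in _ <= X * _]expnS (mulnC 2) -mulnA leq_pmul2l.
have q1 : 0 < 2 ^ g.+1 - 1 by rewrite subn_gt0 expnS; lia.
rewrite -(@leq_pmul2r ((2 ^ g.+1 - 1) ^ (c * 2 ^ g - n))) ?expn_gt0 ?q1 //.
rewrite -mulnA -expnD subnKC //.
apply: (@leq_trans ((2 ^ g.+1) ^ (c * 2 ^ g))).
  rewrite -{2}(subnKC nc) expnD leq_mul2l; apply/orP; right.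
  by case: (c * 2 ^ g - n) => // k; rewrite leq_exp2r // leq_subr.
rewrite mulnC !expnM.
apply: leq_trans (_ : (2 * (2 ^ g.+1 - 1) ^ 2 ^ g) ^ c <= _); last by rewrite expnMn.
by case: (c) => // k; rewrite leq_exp2r.
Qed.

(** Run through [X], keeping the points of [Y] unrelated to the current [x] if
they are at least a [1 - 1 / q] proportion, and otherwise giving up [x] and
keeping the points related to it. The second case occurs at most [b] times,
since it uses up one of the at most [b] neighbours of each remaining point. *)
Lemma common_nonneighbours (T : finType) (r : rel T) q (X Y : {set T}) b :
    0 < q -> {in Y, forall y, #|nbrs r y X| <= b} ->
  exists X' Y' : {set T}, [/\ X' \subset X, Y' \subset Y, #|X| <= #|X'| + b,
    {in X' & Y', forall x y, ~~ r y x} &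
    #|Y| * (q - 1) ^ #|X| <= #|Y'| * q ^ (b + #|X|)].
Proof.
move=> q0; elim: {X}_.+1 {-2}X (ltnSn #|X|) Y b => // n IHn X Xn Y b Yb.
have [->|[x xX]] := set_0Vmem X.
  exists set0, Y; rewrite cards0 addn0 muln1 leq_pmulr ?expn_gt0 ?q0 //.
  by split=> // x y; rewrite inE.
have [->|[y0 y0Y]] := set_0Vmem Y.
  exists X, set0; rewrite cards0 leq_addr; split; rewrite ?sub0set //.
  by move=> u v _; rewrite inE.
pose X1 := X :\ x; have cX : #|X| = #|X1|.+1 by rewrite (cardsD1 x X) xX.
have X1n : #|X1| < n by rewrite -ltnS -cX.
have X1X : X1 \subset X by apply: subD1set.
pose R := [set y in Y | r y x].
have RY : R \subset Y by apply/subsetP=> y; rewrite inE => /andP[].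
have cY : #|Y| = #|R| + #|Y :\: R| by rewrite -(cardsID R Y) (setIidPr RY).
have nbX y : #|nbrs r y X| = r y x + #|nbrs r y X1|.
  rewrite (cardsD1 x) inE xX /=; congr (_ + _); apply: eq_card => z.
  by rewrite !inE andbA.
case: (leqP #|Y| (q * #|R|)) => YR.
  have /card_gt0P[y1 y1R] : 0 < #|R|.
    by have : 0 < #|Y|; [apply/card_gt0P; exists y0 | nia].
  have b0 : 0 < b.
    move: y1R; rewrite inE => /andP[y1Y ry]; have := Yb y1 y1Y.
    by rewrite nbX ry; lia.
  have Rb : {in R, forall y, #|nbrs r y X1| <= b.-1}.
    by move=> y; rewrite inE => /andP[yY ry]; have := Yb y yY; rewrite nbX ry; lia.
  have [X' [Y' [XX YY cX' XY' h]]] := IHn X1 X1n R b.-1 Rb.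
  exists X', Y'; split => //; rewrite ?(subset_trans XX) ?(subset_trans YY) //.
    by lia.
  rewrite cX addnS -addSn -[b](prednK b0) addSn addSn !expnS.
  have := leq_mul YR (leqnn ((q - 1) ^ #|X1|)).
  by move: h; move: (_ ^ _) (_ ^ _) => u v; nia.
have Rb : {in Y :\: R, forall y, #|nbrs r y X1| <= b}.
  by move=> y /setDP[yY _]; have := Yb y yY; rewrite nbX; lia.
have [X' [Y' [XX YY cX' XY' h]]] := IHn X1 X1n (Y :\: R) b Rb.
exists (x |: X'), Y'; split.
- by rewrite subUset sub1set xX (subset_trans XX).
- by apply: subset_trans YY (subsetDl _ _).
- have xX' : x \notin X'.
    by apply: contraTN xX => /(subsetP XX); rewrite !inE eqxx.
  by rewrite cardsU1 xX'; lia.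
- move=> u v /setU1P[->|uX'] vY'; last exact: XY'.
  have := subsetP YY v vY'; rewrite !inE.
  by case: (v \in Y); rewrite ?andbF // andbT.
rewrite cX addnS !expnS.
have : #|Y| * (q - 1) <= q * #|Y :\: R| by nia.
by move: h; move: (_ ^ _) (_ ^ _) => u v; nia.
Qed.

(** From here on, [col true] and [col false] are the two color classes of the
complete graph on [T]. *)
Section MonochromaticPairs.

Context (T : finType) (col : bool -> rel T).
Hypothesis col_sym : forall k, symmetric (col k).
Hypothesis col_irr : forall k, irreflexive (col k).
Hypothesis colN : forall k x y, x != y -> col (~~ k) x y = ~~ col k x y.

Definition clique k (X : {set T}) : Prop :=
  {in X &, forall x y, x != y -> col k x y}.

Definition mono_pair k (X Y : {set T}) : Prop :=
  clique k X /\ {in X & Y, forall x y, col k x y}.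

Lemma mono_pairS k (X X' Y : {set T}) :
  X' \subset X -> mono_pair k X Y -> mono_pair k X' Y.
Proof.
move=> /subsetP X'X [Xk XYk]; split=> [x y /X'X xX /X'X|x y /X'X].
  exact: Xk.
exact: XYk.
Qed.

(** An unbalanced version of the argument of Erdos and Szekeres: move from [A]
to the neighbours of one of its points in the color [~~ k] if they are at
least a [1 - 2 ^ (- g)] proportion of [A], and in the color [k] otherwise. A
step of color [k] costs a factor [2 ^ g.+1] rather than [2 ^ g] to make up for
the chosen point itself. *)
Lemma mono_pair_walk k g n a b (A : {set T}) M : a + b = n -> 0 < M ->
    2 ^ (g.+1 * a + g * b) * M <= #|A| * (2 ^ g - 1) ^ b ->
  (exists X Y : {set T}, [/\ X \subset A, Y \subset A, #|X| = a,
     mono_pair k X Y & M <= #|Y|]) \/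
  (exists X Y : {set T}, [/\ X \subset A, Y \subset A, #|X| = b,
     mono_pair (~~ k) X Y & M <= #|Y|]).
Proof.
move=> abn M0.
have q0 : 0 < 2 ^ g by rewrite expn_gt0.
have scale q p u w x y : p * x <= q * y -> q * w * M <= x * (p * u) ->
    q * (w * M) <= q * (y * u).
  by move=> hxy hx; have := leq_mul hxy (leqnn u); lia.
have triv k' (A' : {set T}) : M <= #|A'| ->
    exists X Y : {set T}, [/\ X \subset A', Y \subset A', #|X| = 0,
      mono_pair k' X Y & M <= #|Y|].
  move=> MA; exists set0, A'; rewrite cards0 sub0set; split=> //.
  by split=> x y; rewrite inE.
elim: n a b abn A => [|n IHn] [|a] [|b] // abn A.
- by rewrite !muln0 !muln1 mul1n => /triv h; left.
- rewrite muln0 add0n => h; left; apply: triv.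
  rewrite -(@leq_pmul2r (2 ^ (g * b.+1))) ?expn_gt0 // mulnC.
  by apply: leq_trans h _; rewrite leq_mul2l expnM leq_exp2r // leq_subr orbT.
- rewrite muln0 addn0 muln1 => h; right; apply: triv; apply: leq_trans h.
  by rewrite leq_pmull // expn_gt0.
move=> h.
have bigA : 2 ^ g.+1 <= #|A|.
  rewrite -(@leq_pmul2r (2 ^ (g * b.+1))) ?expn_gt0 //.
  apply: (@leq_trans (#|A| * (2 ^ g - 1) ^ b.+1)); last first.
    by rewrite leq_mul2l expnM leq_exp2r // leq_subr orbT.
  apply: leq_trans h; rewrite (mulnS g.+1 a) -addnA expnD -mulnA leq_mul2l.
  apply/orP; right; rewrite -[leqLHS]muln1; apply: leq_mul => //.
  by rewrite leq_exp2l // leq_addl.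
have /card_gt0P[v vA] : 0 < #|A| by apply: leq_trans bigA; rewrite expn_gt0.
pose B k' := nbrs (col k') v A.
have BA k' : B k' \subset A by apply/subsetP=> y; rewrite inE => /andP[].
have vB k' : v \notin B k' by rewrite inE col_irr andbF.
have cA : #|A| = (#|B k| + #|B (~~ k)|).+1.
  rewrite (cardsD1 v A) vA -(cardsID (B k) (A :\ v)) add1n.
  congr (_.+1); congr (_ + _).
    apply: eq_card => y; rewrite !inE.
    by case: eqP => [->|]; rewrite ?col_irr ?andbF //= andbA andbb.
  apply: eq_card => y; rewrite !inE.
  case: (eqVneq y v) => [->|yv]; rewrite ?col_irr ?andbF //=.
  by rewrite colN 1?eq_sym // andbC; case: (y \in A).
have extend k' p : (exists X Y : {set T}, [/\ X \subset B k', Y \subset B k',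
      #|X| = p, mono_pair k' X Y & M <= #|Y|]) ->
    exists X Y : {set T}, [/\ X \subset A, Y \subset A,
      #|X| = p.+1, mono_pair k' X Y & M <= #|Y|].
  case=> X [Y [XB YB Xp [Xk XYk] MY]]; exists (v |: X), Y; split=> //.
  - by rewrite subUset sub1set vA (subset_trans XB).
  - exact: subset_trans YB (BA _).
  - by rewrite cardsU1 Xp (contra (subsetP XB v)) ?vB.
  have vBk y : y \in B k' -> col k' v y by rewrite inE => /andP[].
  split=> x y.
    move=> /setU1P[->|xX] /setU1P[->|yX] xy; last exact: Xk.
    - by rewrite eqxx in xy.
    - exact/vBk/(subsetP XB).
    - by rewrite col_sym; exact/vBk/(subsetP XB).
  move=> /setU1P[->|xX] yY; last exact: XYk.
  exact/vBk/(subsetP YB).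
have widen k' k'' p : (exists X Y : {set T}, [/\ X \subset B k', Y \subset B k',
      #|X| = p, mono_pair k'' X Y & M <= #|Y|]) ->
    exists X Y : {set T}, [/\ X \subset A, Y \subset A,
      #|X| = p, mono_pair k'' X Y & M <= #|Y|].
  case=> X [Y [XB YB Xp XYk MY]]; exists X, Y; split=> //.
    exact: subset_trans XB (BA _).
  exact: subset_trans YB (BA _).
(* The successor puts v on the side of color k, so that the points of the other
   color are exactly the remaining ones. *)
case: (leqP (2 ^ g * #|B k|.+1) #|A|) => Bk.
  case: (IHn a.+1 b _ (B (~~ k)));
    [lia | | by move/widen; left | by move/extend; right].
  rewrite -(@leq_pmul2l (2 ^ g)) //.
  have : (2 ^ g - 1) * #|A| <= 2 ^ g * #|B (~~ k)|.
    by move: Bk; rewrite cA; move: (2 ^ g) q0 => q; nia.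
  move: h; rewrite (mulnS g b) addnCA expnD expnS.
  by move=> hA hB; exact: scale hB hA.
case: (IHn a b.+1 _ (B k));
  [lia | | by move/extend; left | by move/widen; right].
rewrite -(@leq_pmul2l (2 ^ g.+1)) ?expn_gt0 //.
have : #|A| <= 2 ^ g.+1 * #|B k|.
  by move: Bk bigA; rewrite expnS; move: (2 ^ g) q0 => q; nia.
move: h; rewrite (mulnS g.+1 a) -addnA expnD.
by move=> hA hB; apply: (@scale _ 1 _ _ #|A|); rewrite mul1n.
Qed.

(** An argument of Erdos and Szemeredi. Let [X] be a largest clique of color
[~~ k] and size at most [2t] in [W]. At least half of the points of [W] have
at most [b] neighbours of color [k] in [X], with [b] a small proportion of
[t]; so all but [b] points of [X] form, with a large set [Y1], a pair of color
[~~ k]. If [X] has size [2t], this pair is as desired. Otherwise [Y1] has no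
clique of color [~~ k] and size [b + 1], as exchanging it for the points given
up would enlarge [X]; hence the unbalanced walk in [Y1] ends with a pair of
color [k], at a low cost because [b + 1] is small. *)
Lemma sparse_mono_pair k g C t M (W : {set T}) :
    {in W, forall x, 2 ^ g.+1 * #|nbrs (col k) x W| <= #|W|} ->
    0 < g -> 2 * t <= C * 2 ^ g.+1 -> 8 * t <= #|W| -> 0 < M ->
    2 ^ (4 * g.+1 * C + 5 * C + g.+1 + 3) * M <= #|W| ->
  exists k' X Y, [/\ mono_pair k' X Y, #|X| = t & M <= #|Y|].
Proof.
move=> Wk g0 tC tW M0 MW.
pose isC (X : {set T}) := [&& X \subset W, #|X| <= 2 * t &
  [forall x in X, forall y in X, (x != y) ==> col (~~ k) x y]].
have isCP (X : {set T}) :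
    reflect [/\ X \subset W, #|X| <= 2 * t & clique (~~ k) X] (isC X).
  apply: (iffP and3P) => -[XW Xt h]; split=> //.
    move=> x y xX yX xy.
    by have /forall_inP/(_ y yX)/implyP := forall_inP h x xX; apply.
  by apply/forall_inP=> x xX; apply/forall_inP=> y yX; apply/implyP; exact: h.
have C0 : isC set0.
  by apply/isCP; rewrite sub0set cards0; split=> // x y; rewrite inE.
have [X [XW Xt Xk Xmax]] : exists X : {set T}, [/\ X \subset W, #|X| <= 2 * t,
    clique (~~ k) X & forall Z : {set T}, isC Z -> #|Z| <= #|X|].
  case: (@arg_maxnP _ set0 isC (fun X => #|X|) C0) => X /isCP[XW Xt Xk] Xmax.
  by exists X.
set q := 2 ^ g.+1 in Wk tC *.
have q4 : 4 <= q by rewrite (@leq_exp2l 2 2).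
have hX : q * links (col k) W X <= #|W| * #|X|.
  rewrite links_sym 1?[leqRHS]mulnC; last exact: col_sym.
  by apply: links_bound => x /(subsetP XW); exact: Wk.
have := few_rich hX.
set D := [set x in W | _] => hD.
have DW : D \subset W by apply/subsetP=> y; rewrite inE => /andP[].
pose Y0 := W :\: D :\: X.
have hY0 : #|W| <= 4 * #|Y0|.
  have := cardsD W D; rewrite (setIidPr DW).
  have := cardsD (W :\: D) X.
  have := subset_leq_card (subsetIr (W :\: D) X); rewrite -/Y0; lia.
pose b := (2 * #|X|) %/ q.
have bt : b <= t.
  rewrite -(@leq_pmul2r q); last by lia.
  by apply: leq_trans (leq_divM _ _) _; nia.
have bC : b <= 2 * C.
  rewrite -(@leq_pmul2r q); last by lia.
  by apply: leq_trans (leq_divM _ _) _; nia.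
have Y0b : {in Y0, forall y, #|nbrs (col k) y X| <= b}.
  move=> y; rewrite !inE => /and3P[_ h yW]; rewrite yW /= -leqNgt in h.
  by rewrite leq_divRL 1?mulnC //; lia.
have q0 : 0 < q by lia.
have [X' [Y1 [X'X Y1Y cX' XY1 hY1]]] := common_nonneighbours q0 Y0b.
have XYk : {in X' & Y1, forall x y, col (~~ k) x y}.
  move=> x y xX yY; rewrite col_sym colN; first exact: XY1.
  have := subsetP Y1Y y yY; rewrite inE => /andP[yX _].
  by apply: contraNneq yX => ->; apply: (subsetP X'X).
have pairX : mono_pair (~~ k) X' Y1.
  by split=> // x y /(subsetP X'X) xX /(subsetP X'X); apply: Xk.
have {}hY1 : #|Y0| <= #|Y1| * 2 ^ (2 * g.+1 * C + 2 * C).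
  have q1 : 0 < (q - 1) ^ #|X| by rewrite expn_gt0; lia.
  rewrite -(leq_pmul2r q1); apply: leq_trans hY1 _; rewrite -mulnA leq_mul2l.
  apply/orP; right; rewrite (expnD q) (expnD 2) -mulnA; apply: leq_mul.
    by rewrite /q -expnM leq_exp2l //; nia.
  by rewrite /q -expnM; apply: pow_loss; rewrite /q expnS in tC; lia.
have {}MW : 2 ^ (2 * g.+1 * C + 3 * C + g.+2) * M <= #|Y1|.
  rewrite -(@leq_pmul2r (2 ^ (2 * g.+1 * C + 2 * C) * 4)); last first.
    by rewrite muln_gt0 expn_gt0.
  apply: (@leq_trans #|W|); last by rewrite mulnA; lia.
  rewrite mulnAC mulnA -expnD -[4]/(2 ^ 2) -expnD; apply: leq_trans MW.
  by rewrite leq_mul2r leq_exp2l //; apply/orP; right; lia.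
case: (ltnP #|X| (2 * t)) => rt; last first.
  have [X2 X2X cX2] := @subset_of_card _ X' t ltac:(lia).
  exists (~~ k), X2, Y1; split=> //; first exact: mono_pairS pairX.
  by apply: leq_trans MW; rewrite leq_pmull // expn_gt0.
case: (@mono_pair_walk (~~ k) g.+1 _ b.+1 t Y1 M erefl M0).
- have tl := @pow_loss g C t ltac:(by rewrite /q expnS in tC; lia).
  rewrite expnD mulnAC.
  apply: (@leq_trans (2 ^ (g.+2 * b.+1) * M * (2 ^ C * (q - 1) ^ t))).
    by rewrite leq_mul2l tl orbT.
  rewrite mulnA leq_mul2r; apply/orP; right; apply: leq_trans MW.
  rewrite mulnAC -expnD leq_mul2r leq_exp2l //; apply/orP; right; nia.
- case=> Z [Y [ZY1 _ cZ [Zk _] _]]; exfalso.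
  have dXZ : [disjoint X' & Z].
    rewrite disjoint_sym disjoints_subset.
    apply/subsetP=> z /(subsetP ZY1)/(subsetP Y1Y).
    by rewrite !inE => /andP[zX _]; apply: contra zX; apply: (subsetP X'X).
  have cXZ : #|X' :|: Z| = #|X'| + b.+1.
    by rewrite cardsU (disjoint_setI0 dXZ) cards0 subn0 cZ.
  (* The exchanged clique may have more than 2t points, so cut it down to one
     point more than X. *)
  have [V VXZ cV] := @subset_of_card _ (X' :|: Z) #|X|.+1 ltac:(lia).
  suff /Xmax : isC V by rewrite cV ltnn.
  apply/isCP; split; [|by rewrite cV|].
    apply: subset_trans VXZ _; rewrite subUset (subset_trans X'X) //=.
    apply: subset_trans ZY1 (subset_trans Y1Y _).
    by apply/subsetP=> y; rewrite !inE => /and3P[].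
  move=> x y /(subsetP VXZ)/setUP[xX|xZ] /(subsetP VXZ)/setUP[yX|yZ] xy.
  + by apply: Xk => //; apply: (subsetP X'X).
  + by apply: XYk => //; apply: (subsetP ZY1).
  + by rewrite col_sym; apply: XYk => //; apply: (subsetP ZY1).
  + exact: Zk.
by case=> Z [Y [_ _ cZ Zp MY]]; exists (~~ ~~ k), Z, Y.
Qed.

End MonochromaticPairs.

(** * Doubling the clique *)

Section Step.

Context (T : finType) (col : bool -> rel T).
Hypothesis col_sym : forall k, symmetric (col k).
Hypothesis col_irr : forall k, irreflexive (col k).
Hypothesis colN : forall k x y, x != y -> col (~~ k) x y = ~~ col k x y.

Definition copy (G : sgraph) k : Prop :=
  exists2 f : G -> T, injective f & forall x y, adj x y -> col k (f x) (f y).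

(** Any injection of [S] into the clique [X] is compatible with an embedding
of the other vertices in [Y]. *)
Lemma copy_from_pair (G : sgraph) k (X Y : {set T}) (S : {set G}) f :
  mono_pair col k X Y -> #|S| <= #|X| -> embeds_in (col k) f (~: S) Y ->
  copy G k.
Proof.
move=> [Xk XYk] SX [fY fI fA].
pose h v := if v \in S then nth (f v) (enum X) (index v (enum S)) else f v.
have idx v : v \in S -> index v (enum S) < size (enum X).
  move=> vS; rewrite -cardE; apply: leq_trans SX.
  by rewrite cardE index_mem mem_enum.
have hX v : v \in S -> h v \in X.
  by move=> vS; rewrite /h vS -mem_enum mem_nth // idx.
have hY v : v \notin S -> h v \in Y.
  by move=> vS; rewrite /h (negbTE vS) fY // inE.
have XY x y : x \in X -> y \in Y -> x != y.
  by move=> xX yY; apply: contraTneq (XYk x y xX yY) => ->; rewrite col_irr.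
have hI : injective h.
  move=> u v; case: (boolP (u \in S)) (boolP (v \in S)) => uS [] vS.
  - rewrite /h uS vS (set_nth_default (f v)) ?idx // => /eqP.
    rewrite nth_uniq ?enum_uniq ?idx // => /eqP huv.
    rewrite -(nth_index u (_ : u \in enum S)) ?mem_enum // huv.
    by rewrite nth_index ?mem_enum.
  - by move=> E; have := XY _ _ (hX u uS) (hY v vS); rewrite E eqxx.
  - by move=> E; have := XY _ _ (hX v vS) (hY u uS); rewrite E eqxx.
  by rewrite /h (negbTE uS) (negbTE vS); apply: fI; rewrite inE.
exists h => // u v uv.
case: (boolP (u \in S)) (boolP (v \in S)) => uS [] vS.
- apply: Xk; rewrite ?hX // (inj_eq hI).
  by apply: contraTneq uv => ->; rewrite adj_irrefl.
- by apply: XYk; [apply: hX | apply: hY].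
- by rewrite col_sym; apply: XYk; [apply: hX | apply: hY].
by rewrite /h (negbTE uS) (negbTE vS); apply: fA; rewrite ?inE.
Qed.

Lemma copy_from_big_pair (G : sgraph) k (X Y : {set T}) :
  mono_pair col k X Y -> 0 < #|Y| -> #|G| <= #|X| -> copy G k.
Proof.
move=> XY /card_gt0P[y0 _] GX.
apply: (copy_from_pair (S := [set: G]) (f := fun=> y0)) XY _ _; rewrite ?cardsT //.
by split=> u; rewrite !inE.
Qed.

(** The sparse set is built with density parameter [e = g + 5]: the loss of a
factor [16] in passing to bounded degree leaves the bound [2 ^ (- g.+1)]
required by [sparse_mono_pair]. The exponent of [2] in the bound on [#|Y|] is
the sum of the costs of [e] rounds of [sparse_pairs_sparse_set] and of
[sparse_mono_pair]. *)
Lemma mono_pair_step (G : sgraph) k (X Y : {set T}) m t d g C M :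
    ~ copy G k -> #|edges G| <= m ->
    mono_pair col k X Y -> #|X| = t -> t <= #|G| ->
    2 * m < d.+1 * t -> 0 < g -> 2 * (2 * t) <= C * 2 ^ g.+1 -> 2 * #|G| < M ->
    2 ^ (((g + 6) * d + 3) * (g + 5) + (4 * g.+1 * C + 5 * C)) * M <= #|Y| ->
  exists k' X' Y', [/\ mono_pair col k' X' Y', #|X'| = 2 * t & M <= #|Y'|].
Proof.
move=> noG Gm XYk Xt tG dt g0 tC GM bigY.
have t0 : 0 < t by case: (t) dt; rewrite ?muln0.
have [S St Sdeg] := top_degrees tG.
have degS : {in ~: S, forall v, deg v <= d}.
  move=> v; rewrite inE => /Sdeg h; rewrite -ltnS -(@ltn_pmul2r t) //.
  by apply: leq_ltn_trans dt; apply: leq_trans h _; rewrite leq_mul2l Gm.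
pose e := g + 5; pose l := (e.+1 * d).+1.
pose u0 := 2 ^ (4 * g.+1 * C + 5 * C) * M.
have uM : M <= u0 by rewrite leq_pmull // expn_gt0.
have el : 2 ^ (e * d) <= 2 ^ l by rewrite leq_exp2l // /l; lia.
pose M0 := (2 * #|G| * 2 ^ (e * d)).+1.
have pairs (Y' : {set T}) : Y' \subset Y -> M0 <= #|Y'| ->
    exists A B : {set T}, [/\ A \subset Y', B \subset Y',
      #|Y'| <= 2 ^ l * #|A|, #|Y'| <= 2 ^ l * #|B| &
      {in A, forall x, 2 ^ e * #|nbrs (col k) x B| <= #|B|}].
  move=> Y'Y MY'.
  case: (embeds_or_sparse (@col_sym k) degS MY') => [[f [fY fI fA]]|].
    case: noG; apply: (copy_from_pair (S := S) (f := f)) XYk _ _.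
      by rewrite St Xt.
    by split=> // v /fY; apply: (subsetP Y'Y).
  case=> A [B [AY BY hA hB AB]]; exists A, B; split=> //.
  by apply: leq_trans hB _; rewrite leq_mul2r el orbT.
have Mu : M0 <= 2 ^ l * u0.
  apply: (@leq_trans (2 ^ (e * d) * M)); last exact: leq_mul.
  have : 0 < 2 ^ (e * d) by rewrite expn_gt0.
  by rewrite /M0; move: (2 ^ (e * d)) => p; nia.
have bigY' : 2 ^ (l.+2 * e) * u0 <= #|Y|.
  apply: leq_trans bigY; rewrite /u0 mulnA -expnD leq_mul2r leq_exp2l //.
  by apply/orP; right; rewrite /l /e; nia.
have [W [_ cW dW]] :=
  sparse_pairs_sparse_set (@col_sym k) pairs Mu (subxx Y) bigY'.
have {}dW : 2 ^ e * links (col k) W W <= 4 * #|W| ^ 2.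
  have pe : 0 < 2 ^ e by rewrite expn_gt0.
  rewrite -(leq_pmul2l pe) mulnA -expnD; apply: leq_trans dW _.
  by move: (2 ^ e) (#|W| ^ 2) => a b; nia.
have [W' [_ cW' dW']] := half_low_degree dW.
have eE : 2 ^ e = 16 * 2 ^ g.+1.
  by rewrite /e -[16]/(2 ^ 4) -expnD; congr (_ ^ _); lia.
have bigW' : 8 * 2 ^ g.+1 * u0 <= #|W'| by rewrite cW eE in cW'; lia.
apply: (@sparse_mono_pair _ col col_sym col_irr colN k g C (2 * t) M W') => //.
- by move=> x xW'; have := dW' x xW'; rewrite eE; lia.
- apply: leq_trans bigW'; have : 0 < 2 ^ g.+1 by rewrite expn_gt0.
  by move: (2 ^ g.+1) => q; nia.
- exact: leq_ltn_trans GM.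
apply: leq_trans bigW'; rewrite /u0 mulnA leq_mul2r; apply/orP; right.
by rewrite -[8]/(2 ^ 3) -!expnD leq_exp2l //; lia.
Qed.

End Step.

(** * Iterating the doubling *)

Section Iteration.

Context (T : finType) (col : bool -> rel T).
Hypothesis col_sym : forall k, symmetric (col k).
Hypothesis col_irr : forall k, irreflexive (col k).
Hypothesis colN : forall k x y, x != y -> col (~~ k) x y = ~~ col k x y.

Context (G : bool -> sgraph) (m s : nat).
Hypothesis edgesG : forall k, #|edges (G k)| <= m.
Hypothesis cardG : forall k, #|G k| <= 2 * m.
Hypothesis ms : 2 * m <= 3 * s ^ 2.
Hypothesis s_large : 6 * s ^ 2 < 2 ^ s.
Hypothesis noG : forall k, ~ copy col (G k) k.

(** A round at level [p] costs at most [s * q p / 2 ^ p] in the exponent,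
where [q p = 12 * p ^ 2 + 128 * p + 232]. The polynomial [budget] solves
[budget p = q p + budget p.+1 / 2], so [s * budget p / 2 ^ p] pays for all
rounds from level [p] on. *)
Definition budget p := 24 * p ^ 2 + 304 * p + 792.

(** The summand [2 ^ p] added to the budget keeps [2 ^ s <= #|Y|] throughout.
The induction on [j] expresses that the doubling stops at the latest when [3 *
s <= 2 ^ p]: the clique then has at least [3 * s ^ 2] points, and [G k] has no
more vertices than that. *)
Lemma no_large_pair j p k (X Y : {set T}) E : 3 * s <= 2 ^ (p + j) ->
    mono_pair col k X Y -> #|X| = s * 2 ^ p ->
    s * (budget p + 2 ^ p) <= E * 2 ^ p -> 2 ^ E <= #|Y| -> False.
Proof.
elim: j p k X Y E => [|j IHj] p k X Y E sp XYk cX sE EY.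
  apply: (noG (k := k)); apply: (copy_from_big_pair col_sym col_irr) XYk _ _.
    by apply: leq_trans EY; rewrite expn_gt0.
  by rewrite cX; have := cardG k; rewrite addn0 in sp; nia.
have Y0 : 0 < #|Y| by apply: leq_trans EY; rewrite expn_gt0.
case: (leqP #|G k| #|X|) => [GX|XG].
  by apply: (noG (k := k)); apply: (copy_from_big_pair col_sym col_irr) XYk _ _.
have cardGs b : #|G b| <= 3 * s ^ 2 by apply: leq_trans ms.
set t := s * 2 ^ p in cX.
have pp : 0 < 2 ^ p by rewrite expn_gt0.
have s0 : 0 < s by have := cardGs k; move: XG; case: (s) => //; lia.
have t0 : 0 < t by rewrite muln_gt0 s0 pp.
(* This absorbs the constant terms of the cost of a round into multiples of
   s / 2 ^ p. *)
have p3s : 2 ^ p < 3 * s.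
  rewrite -(ltn_pmul2l s0); have := cardGs k; rewrite cX /t in XG.
  by rewrite -mulnn; lia.
pose d := (2 * m) %/ t; pose C := (s %/ 2 ^ p).+1.
have dt : 2 * m < d.+1 * t by exact: ltn_ceil.
have dp : d * 2 ^ p <= 3 * s.
  have := leq_divM (2 * m) t; rewrite -/d /t => h.
  by rewrite -(leq_pmul2l s0); move: ms; rewrite -mulnn; lia.
have Cp : C * 2 ^ p <= 4 * s.
  by have := leq_divM s (2 ^ p); rewrite /C mulSn; lia.
have sC : s <= C * 2 ^ p by apply/ltnW; exact: ltn_ceil.
(* With density 4 ^ (- p.+1) the cliques cost about s * p / 2 ^ p, less than
   the sparse set does. *)
pose g := 2 * p + 1.
pose L := ((g + 6) * d + 3) * (g + 5) + (4 * g.+1 * C + 5 * C).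
have LE : L * 2 ^ p <= s * (12 * p ^ 2 + 128 * p + 232).
  rewrite /L /g; move: (2 ^ p) pp p3s dp Cp => q pp p3s dp Cp; rewrite -mulnn.
  have h1 : (2 * p + 7) * (2 * p + 6) * (d * q)
      <= (2 * p + 7) * (2 * p + 6) * (3 * s).
    by rewrite leq_mul2l dp orbT.
  have h2 : 3 * (2 * p + 6) * q <= 3 * (2 * p + 6) * (3 * s).
    by rewrite leq_mul2l ltnW ?orbT.
  have h3 : (8 * p + 13) * (C * q) <= (8 * p + 13) * (4 * s).
    by rewrite leq_mul2l Cp orbT.
  by lia.
have sE' : s * (budget p.+1 + 2 ^ p.+1) <= (E - L) * 2 ^ p.+1.
  rewrite mulnBl !expnS; move: sE LE; rewrite /budget -!mulnn.
  by move: (2 ^ p) => q; lia.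
have LE' : L <= E.
  rewrite -(leq_pmul2r pp); apply: leq_trans LE _; apply: leq_trans sE.
  by rewrite leq_mul2l /budget; lia.
have sEL : s <= E - L.
  rewrite -(@leq_pmul2r (2 ^ p.+1)) ?expn_gt0 //; apply: leq_trans sE'.
  by rewrite leq_mul2l leq_addl orbT.
have [|||||k' [X' [Y' [XY' cX' EY']]]] := @mono_pair_step _ _ col_sym col_irr colN
  (G k) k X Y m t d g C (2 ^ (E - L)) (noG (k := k)) (edgesG k) XYk cX _ dt.
- by rewrite -cX ltnW.
- by rewrite /g addn1.
- have -> : 2 ^ g.+1 = 4 * (2 ^ p * 2 ^ p).
    by rewrite -expnD -[4]/(2 ^ 2) -expnD; congr (_ ^ _); rewrite /g; lia.
  have := leq_mul (leqnn (4 * 2 ^ p)) sC.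
  by rewrite /t; lia.
- apply: leq_trans (_ : 2 ^ s <= _); last by rewrite leq_exp2l.
  by apply: leq_ltn_trans s_large; have := cardGs k; lia.
- by rewrite -expnD addnC subnK.
apply: (IHj p.+1 k' X' Y' (E - L)) => //; first by rewrite addSnnS.
by rewrite cX' /t expnS mulnCA.
Qed.

Lemma no_large_copy_free_coloring : 2 ^ (250 * s) <= #|T| -> False.
Proof.
move=> bigT.
(* The first pair, at level p = 5, costs 3 * 32 * s in the exponent. *)
have big : 2 ^ (2 * (s * 2 ^ 5) + 1 * (s * 2 ^ 5)) * 2 ^ (154 * s)
    <= #|[set: T]| * (2 ^ 1 - 1) ^ (s * 2 ^ 5).
  rewrite exp1n muln1 cardsT -expnD; apply: leq_trans bigT.
  by rewrite leq_exp2l //; lia.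
have s3 : 3 * s <= 2 ^ (5 + 3 * s).
  apply/ltnW/(leq_trans (ltn_expl _ (isT : 1 < 2))).
  by rewrite leq_exp2l ?leq_addl.
have sE : s * (budget 5 + 2 ^ 5) <= 154 * s * 2 ^ 5 by rewrite /budget; lia.
have M0 : 0 < 2 ^ (154 * s) by rewrite expn_gt0.
case: (mono_pair_walk col_sym col_irr colN true erefl M0 big).
  by case=> X [Y [_ _ cX XY EY]]; exact: no_large_pair s3 XY cX sE EY.
by case=> X [Y [_ _ cX XY EY]]; exact: no_large_pair s3 XY cX sE EY.
Qed.

End Iteration.

(** * The Ramsey number *)

Lemma floor_sqrt m : exists2 s, s ^ 2 <= m & m < s.+1 ^ 2.
Proof.
elim: m => [|m [s sm ms]]; first by exists 0.
case: (ltnP m.+1 (s.+1 ^ 2)) => h; first by exists s => //; apply: ltnW.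
by exists s.+1 => //; move: ms h; rewrite -!mulnn; lia.
Qed.

Lemma six_square_lt_exp s : 10 <= s -> 6 * s ^ 2 < 2 ^ s.
Proof.
elim: s => // s IHs; rewrite leq_eqVlt => /predU1P[[<-]//|s10].
have ss : 10 * s <= s * s by rewrite leq_mul2r -ltnS s10 orbT.
by have := IHs s10; rewrite (expnS 2 s) -!mulnn; move: (2 ^ s) => q; lia.
Qed.

Lemma ramsey_number_le (G1 G2 : sgraph) N : 0 < N -> arrows G1 G2 N ->
  ramsey_number G1 G2 <= N.
Proof.
by move=> N0 aN; rewrite /ramsey_number; case: ex_minnP => r _; apply; rewrite N0.
Qed.

Lemma arrows_exp_vertices (G1 G2 : sgraph) n :
  #|G1| + #|G2| <= n -> arrows G1 G2 (2 ^ n).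
Proof.
move=> Gn; apply/forallP=> c.
have big : 2 ^ (#|G1| + #|G2|) <= #|[set: 'I_(2 ^ n)]|.
  by rewrite cardsT card_ord leq_exp2l.
case: (mono_clique c erefl big) => -[S [_ SG Sc]].
  by rewrite (clique_copy SG Sc).
by rewrite (clique_copy SG Sc) orbT.
Qed.

Lemma copy_contains_copy (G : sgraph) N (c : coloring N) k :
  copy (color_rel c) G k -> contains_copy G (color_class c k).
Proof.
case=> f fI fA; apply/existsP; exists [ffun x : G => f x : color_class c k].
apply/andP; split; first by apply/injectiveP=> x y; rewrite !ffunE => /fI.
by apply/forallP=> x; apply/forallP=> y; apply/implyP=> xy; rewrite !ffunE; apply: fA.
Qed.

Lemma arrows_sqrt (G1 G2 : sgraph) m s :
    no_isolated G1 -> no_isolated G2 -> #|edges G1| <= m -> #|edges G2| <= m ->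
    m < s.+1 ^ 2 ->
  arrows G1 G2 (2 ^ (250 * s)).
Proof.
move=> iG1 iG2 m1 m2 ms.
have n1 : #|G1| <= 2 * m.
  by apply: leq_trans (card_no_isolated iG1) _; rewrite leq_mul2l m1.
have n2 : #|G2| <= 2 * m.
  by apply: leq_trans (card_no_isolated iG2) _; rewrite leq_mul2l m2.
have ms' : m <= s * (s + 2) by move: ms; rewrite -mulnn; lia.
case: (ltnP s 10) => s10.
  apply: arrows_exp_vertices; apply: (@leq_trans (4 * (s * (s + 2)))); first by lia.
  by rewrite mulnCA [leqRHS]mulnC leq_mul2l; lia.
apply/forallP=> c; apply/negPn/negP; rewrite negb_or => /andP[no1 no2].
pose G (k : bool) := if k then G1 else G2.
apply: (@no_large_copy_free_coloring _ (color_rel c) _ _ _ G m s).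
- exact: color_rel_sym.
- exact: color_rel_irrefl.
- by move=> k x y; rewrite /color_rel => ->; case: (c _) k => [] [].
- by case.
- by case.
- by rewrite -mulnn; nia.
- exact: six_square_lt_exp.
- by case=> /copy_contains_copy; apply/negP.
by rewrite card_ord.
Qed.

Import Order.TTheory GRing.Theory Num.Theory.
Local Open Scope ring_scope.

Theorem corollary1p6 (R : realType) (G1 G2 : sgraph) (m1 m2 m : nat)
    (hm1 : #|edges G1| = m1) (hm2 : #|edges G2| = m2)
    (hG1 : no_isolated G1) (hG2 : no_isolated G2)
    (hm : m = maxn m1 m2) :
  (ramsey_number G1 G2)%:R <= (2 : R) `^ (250%:R * Num.sqrt (m%:R : R)).
Proof.
have [s sm ms] := floor_sqrt m.
have R_le : (ramsey_number G1 G2 <= 2 ^ (250 * s))%N.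
  apply: ramsey_number_le; first by rewrite expn_gt0.
  by apply: (arrows_sqrt hG1 hG2) ms; rewrite ?hm1 ?hm2 hm ?leq_maxl ?leq_maxr.
apply: (@le_trans _ _ ((2 ^ (250 * s))%:R)); first by rewrite ler_nat.
rewrite natrX -powR_mulrn // natrM ler_powR ?ler1n // ler_wpM2l //.
by rewrite -[leLHS]ger0_norm ?ler0n // -sqrtr_sqr ler_wsqrtr // -natrX ler_nat.
Qed.
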